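(* Let $\beta>1$ be a real algebraic number and let $\mathcal{A}$ be a finite set of contiguous integers containing $0$ and $1$. If addition in $\mathrm{Fin}_{\mathcal{A}}(\beta)$ can be performed in parallel, then $\#\mathcal{A}\geqslant \lceil \beta\rceil$.
   Context: For a complex number $\beta$ with $|\beta|>1$ and a finite set $\mathcal{A}\subset\mathbb{C}$ containing $0$, let $\mathrm{Fin}_{\mathcal{A}}(\beta)=\{\sum_{j\in I}x_j\beta^j : I\subset\mathbb{Z}\text{ finite},\ x_j\in\mathcal{A}\}$. A bi-infinite sequence $(u_j)_{j\in\mathbb{Z}}$ with finitely many nonzero entries represents the number $\sum_j u_j\beta^j$. For finite alphabets $\mathcal{A},\mathcal{B}$, a map $\varphi:\mathcal{A}^{\mathbb{Z}}\to\mathcal{B}^{\mathbb{Z}}$ is $p$-local if there are integers $r,t\geqslant 0$ with $p=r+t+1$ and a map $\Phi:\mathcal{A}^p\to\mathcal{B}$ such that for every $u=(u_j)$ and $v=\varphi(u)$ one has $v_j=\Phi(u_{j+t}\cdots u_j\cdots u_{j-r})$ for all $j\in\mathbb{Z}$. A digit set conversion in base $\beta$ from $\mathcal{A}$ to $\mathcal{B}$ (both containing $0$) is a map $\varphi:\mathcal{A}^{\mathbb{Z}}\to\mathcal{B}^{\mathbb{Z}}$ such that whenever $u$ has finitely many nonzero entries, $v=\varphi(u)$ has finitely many nonzero entries and $\sum_j v_j\beta^j=\sum_j u_j\beta^j$; it is computable in parallel if it is $p$-local for some $p\in\mathbb{N}$. Addition in $\mathrm{Fin}_{\mathcal{A}}(\beta)$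 can be performed in parallel if there exists a digit set conversion in base $\beta$ from $\mathcal{A}+\mathcal{A}=\{x+y: x,y\in\mathcal{A}\}$ to $\mathcal{A}$ that is computable in parallel. *)

(* Defs.v *)
From HB Require Import structures.
From mathcomp Require Import all_boot all_order all_algebra.
From mathcomp Require Import finmap.
From mathcomp Require Import mathcomp_extra boolp classical_sets functions.
From mathcomp Require Import cardinality fsbigop reals.
From mathcomp Require Import complex.

Set Implicit Arguments.
Unset Strict Implicit.
Unset Printing Implicit Defensive.

Import Order.TTheory GRing.Theory Num.Theory.

Local Open Scope classical_set_scope.
Local Open Scope ring_scope.

Definition finitely_nonzero (R : realType) (A : {fset R[i]}) (u : int -> A)
  : Prop := finite_set [set j : int | val (u j) != 0].

(* The sum over all j in Z is the finitely supported sum of fsbigop, which is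
   0 by convention when infinitely many terms are nonzero; for a nonzero base
   the terms have the same support as u, so this convention is never used on a
   finitely_nonzero u. *)
Definition represented_number (R : realType) (beta : R[i]) (A : {fset R[i]})
    (u : int -> A) : R[i] :=
  \sum_(j \in [set: int]) (val (u j) * beta ^ j).

(* The word u_{j+t} ... u_j ... u_{j-r} is the tuple with i-th letter
   u_{j+t-i}, 0 <= i < p. *)
Definition p_local (R : realType) (A B : {fset R[i]}) (p : nat)
    (phi : (int -> A) -> (int -> B)) : Prop :=
  exists r t : nat, p = (r + t + 1)%N /\
    exists Phi : p.-tuple A -> B, forall (u : int -> A) (j : int),
      phi u j = Phi [tuple u (j + t%:Z - i%:Z) | i < p].

Definition digit_set_conversion (R : realType) (beta : R[i])
    (A B : {fset R[i]}) (phi : (int -> A) -> (int -> B)) : Prop :=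
  [/\ 0 \in A, 0 \in B &
    forall u : int -> A, finitely_nonzero u ->
      finitely_nonzero (phi u) /\
      represented_number beta (phi u) = represented_number beta u].

Definition computable_in_parallel (R : realType) (A B : {fset R[i]})
    (phi : (int -> A) -> (int -> B)) : Prop :=
  exists p : nat, p_local p phi.

Definition sum_alphabet (R : realType) (A : {fset R[i]}) : {fset R[i]} :=
  [fset (x + y)%R | x in A, y in A]%fset.

Definition parallel_addition (R : realType) (beta : R[i]) (A : {fset R[i]})
  : Prop :=
  exists phi : (int -> sum_alphabet A) -> (int -> A),
    digit_set_conversion beta phi /\ computable_in_parallel phi.

Definition contiguous_integers (R : realType) (A : {fset R[i]}) : Prop :=
  exists m M : int, forall x : R[i],
    x \in A <-> exists2 k : int, m <= k <= M & x = k%:~R.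

(* Main.v *)
(* Repeatedly adding 1 shows that every natural number lies in Fin_A(beta), so it
   suffices to find a natural number outside it when #A < beta. Let m and M be
   the least and the greatest digit, so that M - m < beta - 1. A digit sum with
   leading position j lies, if positive, between
     beta^j (1 + m / (beta - 1))  and  beta^(j+1) M / (beta - 1),
   so no element of Fin_A(beta) lies in any of the gaps
     ]beta^k M / (beta - 1), beta^k (1 + m / (beta - 1))[,
   whose lengths tend to infinity with k; a gap longer than 1 contains a natural
   number. *)

Require Import Defs.
From HB Require Import structures.
From mathcomp Require Import all_boot all_order all_algebra.
From mathcomp Require Import finmap.
From mathcomp Require Import mathcomp_extra boolp classical_sets functions.
From mathcomp Require Import cardinality fsbigop reals.
From mathcomp Require Import complex.
From mathcomp Require Import zify lra.

Set Implicit Arguments.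
Unset Strict Implicit.
Unset Printing Implicit Defensive.

Import Order.TTheory GRing.Theory Num.Theory.

Local Open Scope ring_scope.

(** Entry [i] of the list is [i - N], so multiplying a digit sum over the window by [beta ^ N] gives
    a polynomial in [beta] whose coefficients are listed from degree 0 upwards. *)
Definition window (N : nat) : seq int :=
  [seq i%:Z - N%:Z | i <- iota 0 (N.*2).+1].

Lemma mem_window (N : nat) (j : int) : (j \in window N) = (`|j| <= N)%N.
Proof.
apply/mapP/idP => [[k]|jN]; first by rewrite mem_iota => ? ->; lia.
by exists (absz (j + N%:Z)); rewrite ?mem_iota; lia.
Qed.

Lemma window_uniq (N : nat) : uniq (window N).
Proof. by rewrite map_inj_uniq ?iota_uniq // => i j; lia. Qed.

Lemma fsum_window (V : nmodType) (f : int -> V) (N : nat) :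
  (forall j, f j != 0 -> j \in window N) ->
  \sum_(j \in [set: int]) f j = \sum_(j <- window N) f j.
Proof.
move=> fN; rewrite [RHS]fsbig_seq ?window_uniq //; apply/esym/fsbig_widen => //.
by move=> j [_ jN] /=; apply/eqP/negPn/negP => /fN.
Qed.

Lemma finitely_nonzeroP (R : realType) (A : {fset R[i]}) (u : int -> A) :
  finitely_nonzero u <->
  exists N : nat, forall j, val (u j) != 0 -> j \in window N.
Proof.
split=> [/finite_seqP[s sE]|[N uN]]; last first.
  exact: sub_finite_set uN (finite_seq _).
exists (\max_(j <- s) `|j|)%N => j uj.
rewrite mem_window; apply: (@leq_bigmax_seq _ _ xpredT (fun j => `|j|%N)) => //.
by have : [set` s]%classic j by rewrite -sE.
Qed.

Lemma represented_number_window (R : realType) (beta : R[i]) (A : {fset R[i]})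
    (u : int -> A) (N : nat) :
  (forall j, val (u j) != 0 -> j \in window N) ->
  represented_number beta u = \sum_(j <- window N) val (u j) * beta ^ j.
Proof.
move=> uN; apply: fsum_window => j; rewrite mulf_eq0 negb_or => /andP[uj _].
exact: uN.
Qed.

Lemma natr_representable (R : realType) (beta : R[i]) (A : {fset R[i]})
    (A0 : 0 \in A) (A1 : 1 \in A) (A_parallel : parallel_addition beta A)
    (n : nat) :
  exists2 u : int -> A,
    finitely_nonzero u & represented_number beta u = n%:R.
Proof.
have [phi [[_ _ phiE] _]] := A_parallel.
elim: n => [|n [u /finitely_nonzeroP[N uN] uE]].
  exists (fun=> FSetSub A0).
    by apply/finitely_nonzeroP; exists 0%N => j /=; rewrite eqxx.
  rewrite (@represented_number_window _ _ _ _ 0) => [|j /=]; last by rewrite eqxx.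
  by rewrite big1 // => j _; rewrite mul0r.
(* [d] is the expansion of 1. Its digitwise sum with [u] is a word over the sum alphabet, which
   [phi] turns back into a word over [A] of the same value. *)
pose d (j : int) : R[i] := (j == 0)%:R.
have dA j : d j \in A by rewrite /d; case: (j == 0).
have wA j : val (u j) + d j \in sum_alphabet A.
  by apply/imfset2P; exists (val (u j)); [exact: valP|exists (d j)].
pose w j := FSetSub (wA j).
have wN j : val (w j) != 0 -> j \in window N.
  rewrite /= /d; case: (j =P 0) => [->|_]; first by rewrite mem_window.
  by rewrite addr0; exact: uN.
have /phiE[phiw phiwE] : finitely_nonzero w by apply/finitely_nonzeroP; exists N.
exists (phi w) => //.
rewrite phiwE (represented_number_window _ wN) -natr1 -uE.
rewrite (represented_number_window _ uN).
under eq_bigr do rewrite mulrDl.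
rewrite big_split /=; congr (_ + _).
rewrite (bigD1_seq 0) ?mem_window ?window_uniq //= expr0z mulr1 /d eqxx.
by rewrite big1 ?addr0 // => j /negPf->; rewrite mul0r.
Qed.

(** Comparison with the geometric sums of the constant digits [m] and [M], whose terms [- m] and
    [- M] are then dropped by sign. The factor [beta - 1] avoids a division. *)
Lemma digit_sum_bound (R : realFieldType) (beta m M : R) (e : nat -> R)
    (beta_ge1 : 1 <= beta) (m_le0 : m <= 0) (M_ge0 : 0 <= M)
    (e_bound : forall i, m <= e i <= M) (L : nat) :
  m * beta ^+ L <= (beta - 1) * \sum_(i < L) e i * beta ^+ i <= M * beta ^+ L.
Proof.
suff : m * (beta ^+ L - 1) <= (beta - 1) * \sum_(i < L) e i * beta ^+ i
       <= M * (beta ^+ L - 1)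
  by move: (\sum_(i < L) _) => S /andP[h1 h2]; apply/andP; split; lra.
elim: L => [|L /andP[IH1 IH2]]; first by rewrite big_ord0 expr0 subrr !mulr0 lexx.
have bL : 0 <= (beta - 1) * beta ^+ L.
  by rewrite mulr_ge0 ?subr_ge0 // exprn_ge0 //; lra.
have /andP[e1 e2] := e_bound L.
have := ler_wpM2r bL e1; have := ler_wpM2r bL e2.
rewrite big_ord_recr exprS /= => h1 h2; apply/andP; split; lra.
Qed.

(* The leading digit, if at a position at least k, puts the sum below 0 or
   above the gap; otherwise the sum lies below the gap. *)
Lemma digit_sum_gap (R : realFieldType) (beta m M : R) (e : nat -> R)
    (beta_ge1 : 1 <= beta) (m_le0 : m <= 0) (M_ge0 : 0 <= M)
    (e_bound : forall i, m <= e i <= M) (L k : nat) :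
  M - m <= beta - 1 ->
  (forall i, [\/ e i <= -1, e i = 0 | 1 <= e i]) ->
  (beta - 1) * \sum_(i < L) e i * beta ^+ i <= M * beta ^+ k \/
  (beta - 1 + m) * beta ^+ k <= (beta - 1) * \sum_(i < L) e i * beta ^+ i.
Proof.
move=> gap e_int.
elim: L => [|L IH]; first by left; rewrite big_ord0 mulr0 mulr_ge0 ?exprn_ge0 //; lra.
have [Lk|kL] := ltnP L k.
  left; have /andP[_ /le_trans->] // := digit_sum_bound beta_ge1 m_le0 M_ge0 e_bound L.+1.
  by rewrite ler_wpM2l // ler_weXn2l.
have kL' : beta ^+ k <= beta ^+ L by rewrite ler_weXn2l.
have bk : 0 <= beta ^+ k by rewrite exprn_ge0 //; lra.
have bL : 0 <= (beta - 1) * beta ^+ L.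
  by rewrite mulr_ge0 ?subr_ge0 // exprn_ge0 //; lra.
have /andP[lo hi] := digit_sum_bound beta_ge1 m_le0 M_ge0 e_bound L.
rewrite big_ord_recr /=.
case: (e_int L) => [eL|->|eL]; last 2 first.
- by rewrite mul0r addr0.
(* The scaled sum is at least [(beta - 1 + m) * beta ^+ L]. Lowering [L] to [k] requires a
   nonnegative coefficient, which [gap] and [0 <= M] provide. *)
- right; have := ler_wpM2r bL eL.
  have h : 0 <= beta - 1 + m by lra.
  have := ler_wpM2l h kL'; lra.
(* The scaled sum is at most [(M - (beta - 1)) * beta ^+ L], which is at most 0 by [gap] and
   [m <= 0]. *)
left; have := ler_wpM2r bL eL.
have h : 0 <= beta - 1 - M by lra.
have h0 : 0 <= beta ^+ L by exact: le_trans kL'.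
have := mulr_ge0 h h0; have := mulr_ge0 M_ge0 bk; lra.
Qed.

(** Bernoulli's inequality reduces this to the Archimedean property. *)
Lemma exprn_unbounded (R : archiRealFieldType) (b x : R) :
  1 < b -> exists k : nat, x < b ^+ k.
Proof.
move=> b1; have c0 : 0 < b - 1 by rewrite subr_gt0.
have bern k : 1 + k%:R * (b - 1) <= b ^+ k.
  elim: k => [|k IH]; first by rewrite expr0; lra.
  have k0 : 0 <= k%:R * (b - 1) ^+ 2 :> R by rewrite mulr_ge0 ?ler0n ?sqr_ge0.
  have := ler_wpM2l (ltW (lt_trans ltr01 b1)) IH.
  rewrite exprS -natr1; lra.
exists (Num.truncn (x / (b - 1))).+1; apply: lt_le_trans (bern _).
have := truncnS_gt (x / (b - 1)); rewrite ltr_pdivrMr //; lra.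
Qed.

Lemma contiguous_card (R : realType) (A : {fset R[i]}) (m M : int) :
  (forall x : R[i], x \in A <-> exists2 k : int, m <= k <= M & x = k%:~R) ->
  M - m + 1 <= (#|` A|)%:Z.
Proof.
move=> AP; case: (leP (M - m + 1) 0) => [/le_trans->//|mM].
have <- : (absz (M - m + 1))%:Z = M - m + 1 by lia.
rewrite lez_nat.
pose s : seq R[i] := [seq (m + i%:Z)%:~R | i <- iota 0 (absz (M - m + 1))].
have -> : absz (M - m + 1) = size s by rewrite size_map size_iota.
apply: uniq_leq_size => [|x /mapP[k]].
  by rewrite map_inj_uniq ?iota_uniq // => i j /intr_inj; lia.
by rewrite mem_iota => kN ->; apply/AP; exists (m + k%:Z) => //; lia.
Qed.

Theorem theorem6 (R : realType) (beta : R) (A : {fset R[i]})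
    (beta_gt1 : 1 < beta)
    (beta_alg : algebraicOver (ratr : rat -> R) beta)
    (A_contiguous : contiguous_integers A)
    (A0 : 0 \in A) (A1 : 1 \in A)
    (A_parallel : parallel_addition (beta%:C)%C A) :
  Num.ceil beta <= (#|` A|)%:Z.
Proof.
rewrite ceil_le_int leNgt; apply/negP => card_lt.
have [m [M AP]] := A_contiguous.
have mM := contiguous_card AP.
have [z /andP[m0 M0] /eqP] := (AP 0).1 A0; rewrite eq_sym intr_eq0 => /eqP z0.
rewrite {}z0 in m0 M0.
(* The integer behind a complex digit; the default 0 is taken only outside [A]. *)
pose digit x := xget 0 [set k : int | m <= k <= M /\ x = k%:~R :> R[i]]%classic.
have digitP x : x \in A -> m <= digit x <= M /\ x = (digit x)%:~R.
  move=> /AP[k km xk].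
  exact: (@xgetI _ 0 [set k : int | m <= k <= M /\ x = k%:~R :> R[i]]%classic k).
have {mM} gap : (M%:~R - m%:~R : R) < beta - 1.
  have : (M - m + 1)%:~R <= (#|` A|)%:Z%:~R :> R by rewrite ler_int.
  rewrite !rmorphD rmorphN /=; lra.
have c0 : 0 < beta - 1 by rewrite subr_gt0.
(* The gap at level [k] has length [(beta - 1 + m - M) * beta ^+ k / (beta - 1)]; this [k] makes it
   exceed 1. *)
have [k kP] := exprn_unbounded ((beta - 1) / (beta - 1 + m%:~R - M%:~R)) beta_gt1.
have {}kP : beta - 1 < (beta - 1 + m%:~R - M%:~R) * beta ^+ k.
  by move: kP; rewrite ltr_pdivrMr 1?mulrC//; lra.
set lo : R := M%:~R * beta ^+ k / (beta - 1).
have lo_ge0 : 0 <= lo.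
  by rewrite divr_ge0 ?mulr_ge0 ?ler0z ?exprn_ge0 //; lra.
(* The first natural number above [lo], the lower end of the gap; it is at most [lo + 1], hence
   still inside. *)
pose n := (Num.truncn lo).+1.
have /andP[nlo nhi] : M%:~R * beta ^+ k < (beta - 1) * n%:R
                      < (beta - 1 + m%:~R) * beta ^+ k.
  have /andP[] := truncn_itv lo_ge0; rewrite -/n ler_pdivlMr // ltr_pdivrMr //.
  rewrite /n -natr1 => h1 h2; apply/andP; split; lra.
have [u /finitely_nonzeroP[N uN]] := natr_representable A0 A1 A_parallel n.
rewrite (represented_number_window _ uN) => uE.
pose e i : R := (digit (val (u (i%:Z - N%:Z))))%:~R.
have b0 : beta != 0 by rewrite gt_eqF //; lra.
have eE : \sum_(i < N.*2.+1) e i * beta ^+ i = n%:R * beta ^+ N.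
  (* The digits of [u] are complex, so this real identity is checked after embedding into [R[i]]. *)
  apply: (@complexI R); rewrite rmorphM rmorph_nat -uE mulr_suml big_map.
  rewrite -[iota _ _]/(index_iota 0 N.*2.+1) big_mkord rmorph_sum.
  apply: eq_bigr => i _; rewrite rmorphM /= rmorph_int.
  have [_ <-] := digitP _ (valP (u (i%:Z - N%:Z))).
  rewrite -mulrA !rmorphXn /=.
  rewrite !exprnP -expfzDr ?subrK //.
  by rewrite fmorph_eq0.
have e_bound i : m%:~R <= e i <= M%:~R.
  by rewrite !ler_int; have [] := digitP _ (valP (u (i%:Z - N%:Z))).
have e_int i : [\/ e i <= -1, e i = 0 | 1 <= e i].
  rewrite /e; set y := digit _; case: (ltgtP y 0) => y0.
  - by constructor 1; rewrite -[-1]/((-1)%:~R) ler_int; lia.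
  - by constructor 3; rewrite -[1]/(1%:~R) ler_int; lia.
  - by constructor 2; rewrite y0.
have bN : 0 < beta ^+ N by rewrite exprn_gt0 //; lra.
(* The shift has scaled the sum by [beta ^+ N], so the gap is taken at level [k + N]; cancelling
   [beta ^+ N] returns to level [k], where [n] lies. *)
have := @digit_sum_gap _ beta m%:~R M%:~R e (ltW beta_gt1) _ _ e_bound
  N.*2.+1 (k + N)%N (ltW gap) e_int.
rewrite ler0z lerz0 eE exprD !mulrA !ler_pM2r //.
by move=> /(_ m0 M0)[]; rewrite leNgt ?nlo ?nhi.
Qed.
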